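(* The map $g : \{1/p_n : n \geq 1\} \to \{1/n : n \geq 1\}$, $g(1/p_n) = 1/n$, is Hölder of all orders but not Lipschitz. That is: (i) for every $\alpha \in (0,1)$ there exists a constant $c \geq 1$ such that \[ \left|\frac{1}{n} - \frac{1}{m}\right| \leq c \left|\frac{1}{p_n} - \frac{1}{p_m}\right|^{\alpha} \] for all integers $m, n \geq 1$; (ii) there is no constant $c \geq 1$ such that \[ \left|\frac{1}{n} - \frac{1}{m}\right| \leq c \left|\frac{1}{p_n} - \frac{1}{p_m}\right| \] for all integers $m, n \geq 1$.
   Context: $p_n$ denotes the $n$th prime number, indexed by positive integers $n \geq 1$ in increasing order ($p_1 = 2$, $p_2 = 3$, ...). A map $f : X \to Y$ between bounded subsets of Euclidean space is Hölder of order $\alpha \in (0,1)$ if there exists a constant $c \geq 1$ such that $|f(x) - f(y)| \leq c |x-y|^\alpha$ for all $x, y \in X$, and Lipschitz if this holds with $\alpha = 1$. *)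

(* Defs.v *)
From HB Require Import structures.
From mathcomp Require Import all_boot all_order all_algebra.
From mathcomp Require Import all_classical all_reals all_analysis.

Set Implicit Arguments.
Unset Strict Implicit.
Unset Printing Implicit Defensive.

Import Order.TTheory GRing.Theory Num.Theory.
Import numFieldNormedType.Exports.

Local Open Scope classical_set_scope.
Local Open Scope ring_scope.

Lemma next_prime_proof (n : nat) : exists p, (n < p)%N && prime p.
Proof. by have [p np pp] := prime_above n; exists p; rewrite np. Qed.

Definition next_prime (n : nat) : nat := ex_minn (next_prime_proof n).

(* Indexed from 1: nth_prime 1 = 2, nth_prime 2 = 3, and so on. The value
   nth_prime 0 = 0 is junk (not a prime). *)
Definition nth_prime (n : nat) : nat := iter n next_prime 0%N.

Lemma nth_prime_prime (n : nat) : (0 < n)%N -> prime (nth_prime n).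
Proof.
by case: n => // n _; rewrite /nth_prime iterS /next_prime;
  case: ex_minnP => p /andP[].
Qed.

Lemma nth_primeS_gt (n : nat) : (nth_prime n < nth_prime n.+1)%N.
Proof.
by rewrite {2}/nth_prime iterS /next_prime; case: ex_minnP => p /andP[].
Qed.

Lemma nth_primeS_min (n p : nat) :
  prime p -> (nth_prime n < p)%N -> (nth_prime n.+1 <= p)%N.
Proof.
move=> pp np; rewrite {1}/nth_prime iterS /next_prime.
by case: ex_minnP => q _; apply; rewrite np.
Qed.

Lemma nth_prime_onto (p : nat) :
  prime p -> exists2 n, (0 < n)%N & nth_prime n = p.
Proof.
move=> pp; have n_le n : (n <= nth_prime n)%N.
  by elim: n => // n IH; apply: leq_ltn_trans (nth_primeS_gt n).
have exn : exists n, (p <= nth_prime n)%N by exists p.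
case: (ex_minnP exn) => -[|n] pn nmin.
  by move: pn; rewrite leqn0 => /eqP p0; rewrite p0 in pp.
exists n.+1 => //; apply/eqP; rewrite eqn_leq pn andbT nth_primeS_min //.
by rewrite ltnNge; apply/negP => /nmin; rewrite ltnn.
Qed.

Definition prime_reciprocals (R : realType) : set R :=
  [set (nth_prime n)%:R^-1 | n in [set n | (0 < n)%N]].

Definition reciprocals (R : realType) : set R :=
  [set n%:R^-1 | n in [set n | (0 < n)%N]].

Arguments prime_reciprocals : clear implicits.
Arguments reciprocals : clear implicits.

Definition holder_on (R : realType) (V W : normedModType R) (alpha : R)
    (X : set V) (f : V -> W) : Prop :=
  exists2 c : R, 1 <= c &
    forall x y : V, X x -> X y -> `|f x - f y| <= c * `|x - y| `^ alpha.

(* A map of type {fun X >-> Y} is given by a total function on R sending X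
   to Y; its values outside X are irrelevant to holder_on and [lipschitz _]. *)
Definition is_prime_reciprocal_map (R : realType)
    (g : {fun prime_reciprocals R >-> reciprocals R}) : Prop :=
  forall n : nat, (0 < n)%N -> g (nth_prime n)%:R^-1 = n%:R^-1.

(* Main.v *)
Require Import Defs.
From HB Require Import structures.
From mathcomp Require Import all_boot all_order all_algebra.
From mathcomp Require Import all_classical all_reals all_analysis.
From mathcomp Require Import zify ring lra.

Import Order.TTheory GRing.Theory Num.Theory.
Import numFieldNormedType.Exports.

(* Both parts follow from Chebyshev-type estimates. On the one hand every prime
   power dividing 'C(n, k) is at most n, so that with P = p_n we have
   2 ^ (P / 2) <= 'C(P, P / 2) <= P ^ n, whence P ^ beta = O(n) for every
   beta < 1; since moreover p_m - p_n >= m - n, this yields the Hoelder bound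
   with beta = (1 + alpha) / 2. On the other hand a Lipschitz bound would force
   p_n <= C n, which is impossible because n! is at most the product of the first
   n primes, while the product of the primes up to x is exponential in x. *)

(** * Monotonicity of the sequence of primes *)

Lemma ltn_nth_prime : {homo nth_prime : m n / (m < n)%N}.
Proof. by apply: homo_ltn => [? ? ?|i]; [apply: ltn_trans|apply: nth_primeS_gt]. Qed.

Lemma leq_nth_prime : {homo nth_prime : m n / (m <= n)%N}.
Proof.
by move=> m n; rewrite leq_eqVlt => /predU1P[->//|/ltn_nth_prime /ltnW].
Qed.

Lemma nth_prime_inj : injective nth_prime.
Proof.
by move=> m n; case: (ltngtP m n) => // /ltn_nth_prime; lia.
Qed.

Lemma nth_prime_ge (n : nat) : (n <= nth_prime n)%N.
Proof. by elim: n => // n IH; apply: leq_ltn_trans (nth_primeS_gt n). Qed.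

(** Consecutive terms differ by at least 1. The additive form avoids truncated subtraction. *)
Lemma nth_prime_gap (m n : nat) :
  (m <= n)%N -> (n + nth_prime m <= m + nth_prime n)%N.
Proof.
move=> /subnKC <-; elim: (n - m)%N => [|d IH]; first by rewrite addn0.
by rewrite addnS; have := nth_primeS_gt (m + d); lia.
Qed.

(** Indices start at 1, which leaves out the junk value [nth_prime 0]. *)
Definition first_primes (n : nat) : seq nat := [seq nth_prime i | i <- iota 1 n].

Lemma first_primes_uniq n : uniq (first_primes n).
Proof. by rewrite map_inj_uniq ?iota_uniq //; apply: nth_prime_inj. Qed.

Lemma mem_first_primes n p :
  (p \in first_primes n) = prime p && (p <= nth_prime n)%N.
Proof.
apply/mapP/andP => [[i]|[pp]].
  rewrite mem_iota add1n ltnS => /andP[i0 ile] ->.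
  by rewrite nth_prime_prime // leq_nth_prime.
have [i i0 <-] := nth_prime_onto pp => le_in; exists i => //.
rewrite mem_iota add1n ltnS i0 leqNgt; apply/negP => /ltn_nth_prime; lia.
Qed.

(** * Binomial coefficients and a lower bound on the number of primes *)

(** Legendre's formula: the terms with [k > n] vanish since [p ^ k > n]. A common range lets several
    factorials be compared term by term. *)
Lemma logn_fact_widen p n m : prime p -> (n <= m)%N ->
  logn p n`! = \sum_(1 <= k < m.+1) n %/ p ^ k.
Proof.
move=> pp nm; rewrite logn_fact // [RHS](@big_cat_nat _ _ _ n.+1) //=.
rewrite -[LHS]addn0; congr addn; apply/esym.
rewrite big_nat big1 // => i /andP[ni _].
by rewrite divn_small // (ltn_trans ni) // ltn_expl // prime_gt1.
Qed.

(* Kummer: each of the [trunc_log p n] digits contributes at most one carry. *)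
Lemma logn_bin_le p n k : prime p -> (k <= n)%N ->
  (logn p 'C(n, k) <= trunc_log p n)%N.
Proof.
move=> pp kn; have p1 := prime_gt1 pp.
case: n kn => [|n] kn.
  by move: kn; rewrite leqn0 => /eqP ->; rewrite bin0 logn1.
have lt_n : (trunc_log p n.+1 < n.+1)%N.
  by apply: leq_trans (trunc_logP p1 (ltn0Sn n)); apply: ltn_expl.
have lt_n1 := leqW lt_n.
have := congr1 (logn p) (bin_fact kn).
rewrite (logn_fact_widen _ _ _ pp (leqnn n.+1)).
rewrite !lognM ?muln_gt0 ?fact_gt0 ?bin_gt0 //.
rewrite (logn_fact_widen _ _ _ pp kn) (logn_fact_widen _ _ _ pp (leq_subr k n.+1)).
rewrite -big_split /=.
set S := (X in (_ + X)%N = _) => e.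
suff : (\sum_(1 <= i < n.+2) n.+1 %/ p ^ i <= trunc_log p n.+1 + S)%N by lia.
(* Up to the cut, the floor of a sum exceeds the sum of the floors by at most 1; beyond it,
   [p ^ i > n.+1] and the left-hand terms vanish. *)
rewrite (@big_cat_nat _ _ _ (trunc_log p n.+1).+1) //=.
rewrite /S [in leqRHS](@big_cat_nat _ _ _ (trunc_log p n.+1).+1) //= addnA.
apply: leq_add.
  have {2}<- : \sum_(1 <= i < (trunc_log p n.+1).+1) 1 = trunc_log p n.+1.
    by rewrite sum_nat_const_nat subn1 muln1.
  rewrite -big_split /=.
  apply: leq_sum => i _.
  have pi0 : (0 < p ^ i)%N by rewrite expn_gt0 prime_gt0.
  have := divn_eq k (p ^ i); have := divn_eq (n.+1 - k) (p ^ i).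
  have := ltn_pmod k pi0; have := ltn_pmod (n.+1 - k) pi0.
  move=> *; rewrite -ltnS ltn_divLR //; nia.
rewrite big_nat big1 // => i /andP[ti _]; rewrite divn_small //.
by apply: leq_trans (trunc_log_ltn _ p1) _; rewrite leq_exp2l.
Qed.

(** The prime powers in the factorization are each at most [P]; so are the primes themselves, hence
    at most [n] of them occur. *)
Lemma bin_nth_prime_le n k : (0 < n)%N -> (k <= nth_prime n)%N ->
  ('C(nth_prime n, k) <= nth_prime n ^ n)%N.
Proof.
move=> n0 kn; set P := nth_prime n in kn *.
have P0 : (0 < P)%N := prime_gt0 (nth_prime_prime n0).
have C0 : (0 < 'C(P, k))%N by rewrite bin_gt0.
have pleP p : prime p -> (p ^ logn p 'C(P, k) <= P)%N.
  move=> pp; apply: leq_trans (trunc_logP (prime_gt1 pp) P0).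
  by rewrite leq_exp2l ?prime_gt1 // logn_bin_le.
rewrite [leqLHS](prod_prime_decomp C0) prime_decompE big_map /=.
apply: (@leq_trans (\prod_(p <- primes 'C(P, k)) P)).
  rewrite big_seq [leqRHS]big_seq; apply: leq_prod => p.
  by rewrite mem_primes => /andP[/pleP].
rewrite big_const_seq count_predT -Monoid.iteropE -/(expn _ _) leq_pexp2l //.
apply: (@leq_trans (size (first_primes n))); last by rewrite size_map size_iota.
apply: uniq_leq_size (primes_uniq _) _ => p.
rewrite mem_primes mem_first_primes => /and3P[pp _ pC].
rewrite pp /= (leq_trans _ (pleP _ pp)) //.
by rewrite -[leqLHS]expn1 leq_exp2l ?prime_gt1 // logn_gt0 mem_primes pp C0.
Qed.

(** Passing from ['C(n, k)] to ['C(n.+1, k.+1)] multiplies by [(n + 1) / (k + 1)], which is at least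
    2 here. *)
Lemma leq_exp2_bin k n : (k.*2 <= n)%N -> (2 ^ k <= 'C(n, k))%N.
Proof.
elim: k n => [n|k IH [//|n] kn]; first by rewrite bin0.
rewrite -(leq_pmul2l (ltn0Sn k)) -mul_bin_diag expnS mulnA.
by apply: leq_mul; [lia|apply: IH; lia].
Qed.

Lemma exp2_half_nth_prime_le n : (0 < n)%N ->
  (2 ^ (nth_prime n)./2 <= nth_prime n ^ n)%N.
Proof.
move=> n0; apply: leq_trans (bin_nth_prime_le _ _ n0 _).
  by apply: leq_exp2_bin; lia.
by lia.
Qed.

(** * Products of primes, and superlinear growth of the primes *)

Lemma dvdn_prod_primes (s : seq nat) N : uniq s -> all prime s ->
  {in s, forall p, p %| N}%N -> (\prod_(p <- s) p %| N)%N.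
Proof.
elim: s => [|p s IH] /=; first by rewrite big_nil dvd1n.
move=> /andP[ps us] /andP[pp sp] sN; rewrite big_cons Gauss_dvd; last first.
  rewrite coprime_sym big_seq; apply: (big_ind (coprime^~ p)) => [|x y xp yp|q qs].
  - by rewrite coprime1n.
  - by rewrite coprimeMl xp.
  - rewrite coprime_sym prime_coprime // dvdn_prime2 ?(allP sp q) //.
    by apply: contraNneq ps => ->.
rewrite sN ?mem_head // IH // => q qs; apply: sN.
by rewrite inE qs orbT.
Qed.

(** The [k]-subsets are counted among all subsets. *)
Lemma bin_leq_exp2 n k : ('C(n, k) <= 2 ^ n)%N.
Proof.
rewrite -[n in leqLHS]card_ord -card_draws -[n in leqRHS]card_ord.
rewrite -cardsT -card_powerset subset_leq_card //; apply/fintype.subsetP => A _.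
by rewrite powersetE finset.subsetT.
Qed.

Lemma prime_dvd_fact p n : prime p -> (p %| n`!)%N = (p <= n)%N.
Proof.
move=> pp; apply/idP/idP => [|pn]; last by rewrite dvdn_fact // prime_gt0.
elim: n => [|n IH]; first by rewrite fact0 dvdn1 => /eqP p1; rewrite p1 in pp.
by rewrite factS Euclid_dvdM // => /orP[/dvdn_leq->//|/IH /leqW].
Qed.

(** Such primes divide [(2n)!] but not [n!], so their product divides the central binomial
    coefficient. *)
Lemma prod_primes_double_le n (s : seq nat) : uniq s -> all prime s ->
  {in s, forall p, n < p <= n.*2}%N -> (\prod_(p <- s) p <= 4 ^ n)%N.
Proof.
move=> us ps sn; apply: (@leq_trans 'C(n.*2, n)); last first.
  by apply: leq_trans (bin_leq_exp2 _ _) _; rewrite -mul2n (expnM 2 2).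
apply: dvdn_leq; first by rewrite bin_gt0 -addnn leq_addr.
apply: dvdn_prod_primes => // p pinss; have pp := allP ps p pinss.
have /andP[np pn] := sn p pinss.
have := bin_fact (leq_addr n n); rewrite addKn => /(congr1 (dvdn p)).
by rewrite !Euclid_dvdM // !prime_dvd_fact // addnn pn orbb [(p <= n)%N]leqNgt np orbF.
Qed.

(** Dyadic induction: with [N = 2 ^ k], the primes up to [N] and those in [(N, 2N]] contribute at
    most [4 ^ N] each. *)
Lemma prod_primes_le k (s : seq nat) : uniq s -> all prime s ->
  all (leq^~ (2 ^ k)%N) s -> (\prod_(p <- s) p <= 4 ^ 2 ^ k)%N.
Proof.
elim: k s => [|k IH] s us ps sk.
  rewrite big_seq big1 // => p pinss.
  by have := prime_gt1 (allP ps p pinss); have := allP sk p pinss; rewrite /=; lia.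
have e : (2 ^ k.+1 = (2 ^ k).*2)%N by rewrite expnS mul2n.
rewrite {}e in sk *; set N := (2 ^ k)%N in IH sk *.
rewrite -addnn expnD (bigID (leq^~ N)) /= -[X in (X * _)%N]big_filter.
rewrite -[X in (_ * X)%N]big_filter.
have filter_primes (a : pred nat) : all prime (seq.filter a s).
  by apply/allP => p; rewrite mem_filter => /andP[_ /(allP ps)].
apply: leq_mul.
  by apply: IH; rewrite ?filter_uniq ?filter_all.
apply: prod_primes_double_le; rewrite ?filter_uniq // => p.
by rewrite mem_filter -ltnNge => /andP[-> /(allP sk)].
Qed.

Lemma fact_le_prod_first_primes n : (n`! <= \prod_(p <- first_primes n) p)%N.
Proof.
rewrite big_map fact_prod /index_iota subn1.
by apply: leq_prod => i _; apply: nth_prime_ge.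
Qed.

(** The last [n] factors of the factorial all exceed [a]. *)
Lemma expn_leq_fact a n : (a ^ n <= (a + n)`!)%N.
Proof.
elim: n => [|n IH]; first by rewrite fact_gt0.
by rewrite addnS factS expnS leq_mul // ltnW // ltnS leq_addr.
Qed.

Lemma nth_prime_not_linear c : exists2 n, (0 < n)%N & (c * n < nth_prime n)%N.
Proof.
suff /existsNP[n /not_implyP[n0 /negP]] :
    ~ forall n, (0 < n)%N -> (nth_prime n <= c * n)%N.
  by rewrite -ltnNge; exists n.
move=> Pc.
have fact_small n : (0 < n)%N -> (n`! <= (16 ^ c) ^ n)%N.
  move=> n0; have c0 : (0 < c)%N.
    by move: (Pc n n0) (nth_prime_ge n); case: (c) => //; lia.
  have cn0 : (0 < c * n)%N by rewrite muln_gt0 c0.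
  apply: leq_trans (fact_le_prod_first_primes n) _.
  (* Round [c * n] up to a power of two [2 ^ t.+1] with [2 ^ t <= c * n]; then [4 ^ 2 ^ t.+1 = 16 ^
     2 ^ t <= 16 ^ (c * n)]. *)
  apply: leq_trans
    (prod_primes_le (trunc_log 2 (c * n)).+1 _ (first_primes_uniq n) _ _) _.
  - by apply/allP => p; rewrite mem_first_primes => /andP[].
  - apply/allP => p; rewrite mem_first_primes => /andP[_ pn].
    apply: leq_trans pn (leq_trans (Pc n n0) _).
    by rewrite ltnW // trunc_log_ltn.
  - by rewrite -expnM expnS expnM leq_exp2l // trunc_logP.
set a := (16 ^ c)%N in fact_small.
have a0 : (0 < a)%N by rewrite expn_gt0.
(* [(a a + 1)^n <= (a a + 1 + n)! <= a^(a a + 1 + n) = a^(2n)] for [n = a a + 1] *)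
have := leq_trans (expn_leq_fact (a * a).+1 (a * a).+1) (fact_small _ _).
by rewrite addnn -mul2n (expnM a 2) -mulnn => /(_ isT); rewrite leq_exp2r // ltnn.
Qed.

(** * Real growth bounds and the Hölder estimate *)

Local Open Scope classical_set_scope.
Local Open Scope ring_scope.

(** Logarithm of the bound [2 ^ P./2 <= P ^ n]; the 4 absorbs the rounding, as [P <= 4 * P./2] for
    [P >= 2]. *)
Lemma nth_prime_le_ln (R : realType) n : (0 < n)%N ->
  (nth_prime n)%:R * ln 2 <= 4 * n%:R * ln (nth_prime n)%:R :> R.
Proof.
move=> n0; set P := nth_prime n.
have P2 : (1 < P)%N := prime_gt1 (nth_prime_prime n0).
have P0 : 0 < P%:R :> R by rewrite ltr0n (ltn_trans _ P2).
have ln2 : 0 < ln 2 :> R by rewrite ln_gt0 // ltr1n.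
have : ln ((2 ^ P./2)%:R) <= ln ((P ^ n)%:R) :> R.
  by rewrite ler_ln ?posrE ?ltr0n ?expn_gt0 ?(ltn_trans _ P2) //
    ler_nat exp2_half_nth_prime_le.
rewrite !natrX !lnXn // -[ln 2 *+ _]mulr_natl -[ln P%:R *+ _]mulr_natl.
have : P%:R <= 4 * (P./2)%:R :> R by rewrite -natrM ler_nat; lia.
nra.
Qed.

Lemma gt0_powRD (R : realType) (x r s : R) :
  0 < x -> x `^ (r + s) = x `^ r * x `^ s.
Proof. by move=> x0; apply: powRD; rewrite (gt_eqF x0); apply: implybT. Qed.

Lemma powRVl (R : realType) (x r : R) : 0 <= x -> x^-1 `^ r = x `^ (- r).
Proof. by move=> x0; rewrite -powR_inv1 // -powRrM mulN1r. Qed.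

Lemma powR_nth_prime_le (R : realType) (beta : R) : 0 < beta < 1 ->
  exists2 K : R, 1 <= K &
    forall n, (0 < n)%N -> (nth_prime n)%:R `^ beta <= K * n%:R.
Proof.
move=> /andP[b0 b1]; have ln2 : 0 < ln 2 :> R by rewrite ln_gt0 // ltr1n.
have d0 : 0 < 1 - beta by rewrite subr_gt0.
exists (1 + 4 / ((1 - beta) * ln 2)).
  by rewrite lerDl divr_ge0 // ltW // mulr_gt0.
move=> n n0; have := nth_prime_le_ln R n n0.
have : 0 < (nth_prime n)%:R :> R by rewrite ltr0n prime_gt0 ?nth_prime_prime.
move: (_%:R) => P P0 Pln.
have Pd0 := powR_gt0 (1 - beta) P0.
have lnP : (1 - beta) * ln P <= P `^ (1 - beta).
  by rewrite -ln_powR ltW // ln_sublinear.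
have PE : P = P `^ beta * P `^ (1 - beta).
  by rewrite -gt0_powRD // addrC subrK powRr1 // ltW.
have n0' : 0 <= n%:R :> R by [].
rewrite mulrDl mul1r; apply: ler_wpDl => //.
rewrite mulrAC ler_pdivlMr ?mulr_gt0 // -(ler_pM2r Pd0).
have -> : P `^ beta * ((1 - beta) * ln 2) * P `^ (1 - beta) = (1 - beta) * (P * ln 2).
  by rewrite [in RHS]PE; ring.
apply: (@le_trans _ _ (4 * n%:R * ((1 - beta) * ln P))).
  by rewrite [leRHS]mulrCA ler_pM2l.
by rewrite ler_wpM2l // mulr_ge0.
Qed.

(* The far case [2 x <= y] only uses the growth of [x]; in the near case the gap
   [d = y - x] satisfies [d ^ 2 <= x y], so that
   [d ^ (1 - alpha) <= (x y) ^ (beta - alpha)]. *)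
Lemma reciprocal_holder (R : realType) (alpha K a b x y : R) :
  let beta := (1 + alpha) / 2 in
  0 < alpha < 1 -> 1 <= K -> 0 < a -> a <= b -> 1 <= x -> x < y ->
  b - a <= y - x -> x `^ beta <= K * a -> y `^ beta <= K * b ->
  a^-1 - b^-1 <= 2 * K ^+ 2 * (x^-1 - y^-1) `^ alpha.
Proof.
move=> beta /andP[al0 al1] K1 a0 ab x1 xy gap xa yb.
have x0 : 0 < x by lra.
have y0 : 0 < y by lra.
have b0 : 0 < b by lra.
have K0 : 0 < K by lra.
have t0 : 0 <= x^-1 - y^-1 by rewrite subr_ge0 lef_pV2 ?posrE // ltW.
have T0 := powR_ge0 (x^-1 - y^-1) alpha.
have aV : a^-1 <= K * (x `^ beta)^-1.
  by rewrite -div1r ler_pdivrMr // mulrAC ler_pdivlMr ?powR_gt0 // mul1r.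
have bV : b^-1 <= K * (y `^ beta)^-1.
  by rewrite -div1r ler_pdivrMr // mulrAC ler_pdivlMr ?powR_gt0 // mul1r.
have [far|near] := leP (2 * x) y.
  apply: (@le_trans _ _ (K * (x^-1) `^ alpha)).
    rewrite -lerBDr opprK (le_trans aV) // ler_wpDr ?invr_ge0 ?(ltW b0) //.
    rewrite ler_pM2l // powRVl ?(ltW x0) // -powRN.
    by rewrite ler_powR // lerN2 /beta; lra.
  have xV : x^-1 <= 2 * (x^-1 - y^-1).
    have : y^-1 <= (2 * x)^-1 by rewrite lef_pV2 ?posrE ?mulr_gt0.
    by rewrite invfM; lra.
  have : x^-1 `^ alpha <= 2 * (x^-1 - y^-1) `^ alpha.
    apply: le_trans (_ : (2 * (x^-1 - y^-1)) `^ alpha <= _).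
      by rewrite ge0_ler_powR ?nnegrE ?invr_ge0 ?mulr_ge0 // ltW.
    by rewrite powRM // ler_wpM2r // ler1_powR ?ler1n // ltW.
  rewrite -(ler_pM2l K0) => /le_trans; apply.
  by have := mulr_ge0 (ltW K0) T0; nra.
set d := y - x in gap *.
have d0 : 0 < d by rewrite subr_gt0.
have xy0 : 0 < x * y by rewrite mulr_gt0.
have -> : a^-1 - b^-1 = (b - a) * (a^-1 * b^-1) by field; lra.
have tE : x^-1 - y^-1 = d * (x * y)^-1 by rewrite /d; field; lra.
have T : (x^-1 - y^-1) `^ alpha = d `^ alpha * (x * y) `^ (- alpha).
  by rewrite tE powRM ?invr_ge0 ?ltW // powRVl ?ltW.
(* Since [beta] is the midpoint of [alpha] and 1, [alpha + 2 (beta - alpha) = 1]. *)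
have dE : d = d `^ alpha * (d ^+ 2) `^ (beta - alpha).
  rewrite -powR_mulrn ?ltW // -powRrM -gt0_powRD //.
  have -> : alpha + 2 * (beta - alpha) = 1 by rewrite /beta; lra.
  by rewrite powRr1 // ltW.
(* Here [y < 2 x], so [d] is below both [x] and [y]. *)
have dxy : (d ^+ 2) `^ (beta - alpha) <= (x * y) `^ (beta - alpha).
  rewrite ge0_ler_powR ?nnegrE ?sqr_ge0 ?(ltW xy0) //; rewrite /beta /d; nra.
apply: (@le_trans _ _ (d * (K * (x `^ beta)^-1 * (K * (y `^ beta)^-1)))).
  apply: ler_pM => //; first by rewrite subr_ge0.
    by rewrite mulr_ge0 // invr_ge0 ltW.
  by rewrite ler_pM // invr_ge0 ltW.
have -> : d * (K * (x `^ beta)^-1 * (K * (y `^ beta)^-1)) =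
          K ^+ 2 * (d * (x * y) `^ (- beta)).
  by rewrite powRN powRM ?ltW // invfM; ring.
suff : d * (x * y) `^ (- beta) <= (x^-1 - y^-1) `^ alpha.
  have := T0; nra.
rewrite T [in leLHS]dE -mulrA ler_wpM2l ?powR_ge0 //.
apply: le_trans (_ : (x * y) `^ (beta - alpha) * (x * y) `^ (- beta) <= _).
  by rewrite ler_wpM2r ?powR_ge0.
rewrite -gt0_powRD //.
by rewrite addrAC subrr add0r.
Qed.

(** * The two statements in terms of indices *)

Lemma nth_prime_reciprocals_holder (R : realType) (alpha : R) : 0 < alpha < 1 ->
  exists2 c : R, 1 <= c &
    forall m n : nat, (0 < m)%N -> (0 < n)%N ->
      `|n%:R^-1 - m%:R^-1|
        <= c * `|(nth_prime n)%:R^-1 - (nth_prime m)%:R^-1| `^ alpha.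
Proof.
move=> /andP[al0 al1]; have beta01 : 0 < (1 + alpha) / 2 < 1 by lra.
have [K K1 HK] := powR_nth_prime_le R _ beta01.
exists (2 * K ^+ 2); first by nra.
move=> m n m0 n0; wlog nm : m n m0 n0 / (n <= m)%N => [hw|].
  have [/hw->//|/ltnW /hw] := leqP n m.
  by rewrite (distrC n%:R^-1) (distrC (nth_prime n)%:R^-1); apply.
move: nm; rewrite leq_eqVlt => /predU1P[<-|nm].
  by rewrite !subrr normr0 mulr_ge0 ?powR_ge0 // mulr_ge0 // sqr_ge0.
have pn0 : (0 < nth_prime n)%N := leq_trans n0 (nth_prime_ge n).
have pnm := ltn_nth_prime _ _ nm.
have pm0 : (0 < nth_prime m)%N := ltn_trans pn0 pnm.
rewrite !ger0_norm; first 1 last.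
- by rewrite subr_ge0 lef_pV2 ?posrE ?ltr0n // ler_nat ltnW.
- by rewrite subr_ge0 lef_pV2 ?posrE ?ltr0n // ler_nat ltnW.
apply: reciprocal_holder => //; rewrite ?al0 ?ltr0n ?ler1n ?ler_nat ?ltr_nat //.
- exact: ltnW.
- rewrite lerBlDr addrAC lerBrDr -!natrD ler_nat [leqRHS]addnC.
  exact: nth_prime_gap (ltnW nm).
- exact: HK.
- exact: HK.
Qed.

(* Compares the points of index [n] and [2 n]. *)
Lemma nth_prime_reciprocals_not_lipschitz (R : realType) :
  ~ exists2 c : R, 1 <= c &
      forall m n : nat, (0 < m)%N -> (0 < n)%N ->
        `|n%:R^-1 - m%:R^-1|
          <= c * `|(nth_prime n)%:R^-1 - (nth_prime m)%:R^-1|.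
Proof.
move=> [c c1 Hc]; have c0 : 0 <= c by lra.
(* As [1/n - 1/(2n) = 1/(2n)], a Lipschitz bound would force [p_n <= 2 c n]; [Num.bound c] is a
   natural number above [c]. *)
have [n n0 nP] := nth_prime_not_linear (2 * Num.bound c).
have n2 : (0 < n.*2)%N by rewrite double_gt0.
have n0' : 0 < n%:R :> R by rewrite ltr0n.
have pn0 : 0 < (nth_prime n)%:R :> R by rewrite ltr0n prime_gt0 ?nth_prime_prime.
have pm0 : 0 < (nth_prime n.*2)%:R :> R by rewrite ltr0n prime_gt0 ?nth_prime_prime.
have pnm : (nth_prime n)%:R <= (nth_prime n.*2)%:R :> R.
  by rewrite ler_nat leq_nth_prime // -addnn leq_addr.
have := Hc _ _ n2 n0; rewrite ger0_norm; last first.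
  by rewrite subr_ge0 lef_pV2 ?posrE ?ltr0n // ler_nat -addnn leq_addr.
rewrite ger0_norm; last by rewrite subr_ge0 lef_pV2 ?posrE.
have -> : n%:R^-1 - n.*2%:R^-1 = (2 * n%:R)^-1 :> R.
  by rewrite -mul2n natrM; field; lra.
have pmV : 0 < (nth_prime n.*2)%:R^-1 :> R by rewrite invr_gt0.
move=> H; have : (2 * n%:R)^-1 <= c / (nth_prime n)%:R.
  by apply: le_trans H _; rewrite ler_wpM2l // lerBlDr lerDl ltW.
rewrite ler_pdivlMr // mulrC ler_pdivrMr ?mulr_gt0 //.
apply/negP; rewrite -ltNge.
move: nP; rewrite -(ltr_nat R) !natrM; apply: le_lt_trans.
by rewrite mulrA [c * 2]mulrC ler_pM2r // ler_pM2l // ltW // archi_boundP.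
Qed.

(** * The map between the sets of reciprocals *)

(** Shows that statements about all such maps are not vacuous. *)
Lemma prime_reciprocal_map_exists (R : realType) :
  exists g : {fun prime_reciprocals R >-> reciprocals R},
    is_prime_reciprocal_map g.
Proof.
(* Recovers the index by choice, unique by injectivity of [nth_prime]; off the domain the default
   index 0 gives the value 0. *)
pose g (x : R) : R :=
  (xget 0%N [set n | (0 < n)%N /\ (nth_prime n)%:R^-1 = x])%:R^-1.
have gE n : (0 < n)%N -> g (nth_prime n)%:R^-1 = n%:R^-1.
  move=> n0; rewrite /g; case: xgetP => [m _ [m0 /invr_inj e]|/(_ n) []//].
  by rewrite (nth_prime_inj _ _ (mulrIn (oner_neq0 R) e)).
have g_fun : {homo g : x / prime_reciprocals R x >-> reciprocals R x}.
  by move=> _ [n n0 <-]; rewrite gE //; exists n.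
by exists (mkfun_fun g_fun) => n n0; apply: gE.
Qed.

Theorem mainTheorem6 (R : realType) :
  [/\ exists g : {fun prime_reciprocals R >-> reciprocals R},
        is_prime_reciprocal_map g,
      forall g : {fun prime_reciprocals R >-> reciprocals R},
        is_prime_reciprocal_map g ->
        (forall alpha : R, 0 < alpha < 1 ->
           holder_on alpha (prime_reciprocals R) g) /\
        ~ [lipschitz g x | x in prime_reciprocals R],
      forall alpha : R, 0 < alpha < 1 ->
        exists2 c : R, 1 <= c &
          forall m n : nat, (0 < m)%N -> (0 < n)%N ->
            `|n%:R^-1 - m%:R^-1|
              <= c * `|(nth_prime n)%:R^-1 - (nth_prime m)%:R^-1| `^ alpha
    & ~ exists2 c : R, 1 <= c &
          forall m n : nat, (0 < m)%N -> (0 < n)%N ->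
            `|n%:R^-1 - m%:R^-1|
              <= c * `|(nth_prime n)%:R^-1 - (nth_prime m)%:R^-1| ].
Proof.
split.
- exact: prime_reciprocal_map_exists.
- move=> g gE; split=> [alpha al01|].
    have [c c1 Hc] := nth_prime_reciprocals_holder R alpha al01.
    exists c => // _ _ [n n0 <-] [m m0 <-].
    by rewrite !gE //; apply: Hc.
  move=> [M [_ lip]]; apply: (nth_prime_reciprocals_not_lipschitz R).
  (* The Lipschitz predicate provides the bound for every constant above some [M]; this one is also
     at least 1. *)
  exists (Num.max M 0 + 1); first by rewrite lerDr le_max lexx orbT.
  move=> m n m0 n0; rewrite -(gE n n0) -(gE m m0).
  apply: (lip (Num.max M 0 + 1) _ ((nth_prime n)%:R^-1, (nth_prime m)%:R^-1)).
    by rewrite ltr_pwDr // le_max lexx.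
  by split; [exists n|exists m].
- exact: nth_prime_reciprocals_holder.
- exact: nth_prime_reciprocals_not_lipschitz.
Qed.
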